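(* Let $N$ be an excluded minor for the class of bicircular matroids, let $r$ be the rank of $N$, and let $E(N)$ be its ground set. Then $|E(N)| \leq 3\binom{r}{2} + r + 4$.
   Context: All graphs and matroids are finite; graphs may have loops and multiple edges. The bicycles of a graph $G=(V,E)$ are the subgraphs of $G$ that are minimal with respect to having more edges than vertices. The bicircular matroid $B(G)$ is the matroid on ground set $E$ whose circuits are the edge sets of the bicycles of $G$. A loopless matroid is bicircular if it is isomorphic to $B(G)$ for some graph $G$. So that the class is minor-closed, loops are allowed: a general matroid is bicircular if deleting all its loops yields a matroid isomorphic to $B(G)$ for some graph $G$. An excluded minor for the class of bicircular matroids is a matroid that is not bicircular but all of whose proper minors are bicircular. *)

(* Defs.v *)
From mathcomp Require Import all_boot.

Set Implicit Arguments.
Unset Strict Implicit.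
Unset Printing Implicit Defensive.

(* The ground set is a subset of a fixed finType, so that a matroid and its
   minors live over the same type. *)
Record matroid (T : finType) := Matroid {
  ground : {set T};
  indep : pred {set T};
  indep_ground : forall I, indep I -> I \subset ground;
  indep0 : indep set0;
  indepS : forall I J : {set T}, I \subset J -> indep J -> indep I;
  indep_aug : forall I J : {set T}, indep I -> indep J -> #|I| < #|J| ->
    exists2 e, e \in J :\: I & indep (e |: I)
}.

Section MatroidTheory.
Variables (T : finType) (M : matroid T).
Implicit Types (I J B C D X : {set T}) (e : T).

Definition rank : nat := \max_(I : {set T} | indep M I) #|I|.

Definition circuit C : bool :=
  minset (fun X => (X \subset ground M) && ~~ indep M X) C.

Definition loops : {set T} := [set e | circuit [set e]].

Definition basis_of X B : bool :=
  maxset (fun I => indep M I && (I \subset X)) B.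

Definition delete_indep D : pred {set T} :=
  fun I => indep M I && [disjoint I & D].

Fact delete_ground D I : delete_indep D I -> I \subset ground M :\: D.
Proof. by case/andP=> hI dI; rewrite subsetD dI (indep_ground hI). Qed.

Fact delete_indep0 D : delete_indep D set0.
Proof. by rewrite /delete_indep indep0 -setI_eq0 set0I eqxx. Qed.

Fact delete_indepS D I J :
  I \subset J -> delete_indep D J -> delete_indep D I.
Proof.
move=> sIJ /andP[hJ dJ]; rewrite /delete_indep (indepS sIJ hJ).
exact: disjointWl sIJ dJ.
Qed.

Fact delete_indep_aug D I J :
  delete_indep D I -> delete_indep D J -> #|I| < #|J| ->
  exists2 e, e \in J :\: I & delete_indep D (e |: I).
Proof.
case/andP=> hI dI /andP[hJ dJ] ltIJ.
have [e eJI heI] := indep_aug hI hJ ltIJ; exists e => //.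
rewrite /delete_indep heI -setI_eq0 setIUl setU_eq0 !setI_eq0 dI andbT.
by move: eJI; rewrite inE disjoints1 => /andP[_ /(disjointFr dJ)->].
Qed.

Definition delete D : matroid T :=
  @Matroid T (ground M :\: D) (delete_indep D) (@delete_ground D)
    (@delete_indep0 D) (@delete_indepS D) (@delete_indep_aug D).

Definition contract_indep C : pred {set T} :=
  fun I => [disjoint I & C] && [exists B, basis_of C B && indep M (I :|: B)].

Lemma basis_ofP X B :
  basis_of X B ->
  [/\ indep M B, B \subset X &
      forall e, e \in X -> indep M (e |: B) -> e \in B].
Proof.
case/maxsetP=> /andP[hB sBX] maxB; split=> // e eX heB.
rewrite -sub1set; apply/setUidPr/maxB; last exact: subsetUr.
by rewrite heB subUset sub1set eX.
Qed.

Lemma basis_of_card X B B' :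
  basis_of X B -> basis_of X B' -> #|B| <= #|B'|.
Proof.
case/basis_ofP=> hB sB _ /basis_ofP[hB' _ maxB'].
rewrite leqNgt; apply/negP => lt; have [e] := indep_aug hB' hB lt.
by rewrite inE => /andP[/negP eB' eB] /(maxB' _ (subsetP sB _ eB)).
Qed.

Fact contract_ground C I : contract_indep C I -> I \subset ground M :\: C.
Proof.
case/andP=> dI /existsP[B /andP[_ hIB]]; rewrite subsetD dI andbT.
exact: subset_trans (subsetUl _ _) (indep_ground hIB).
Qed.

Fact contract_indep0 C : contract_indep C set0.
Proof.
rewrite /contract_indep -setI_eq0 set0I eqxx /=.
have h0 : indep M set0 && (set0 \subset C) by rewrite indep0 sub0set.
have [B mB _] := maxset_exists (P := fun I => indep M I && (I \subset C)) h0.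
by apply/existsP; exists B; rewrite [basis_of _ _]mB set0U; case/basis_ofP: mB.
Qed.

Fact contract_indepS C I J :
  I \subset J -> contract_indep C J -> contract_indep C I.
Proof.
move=> sIJ /andP[dJ /existsP[B /andP[bB hJB]]].
rewrite /contract_indep (disjointWl sIJ dJ); apply/existsP; exists B.
by rewrite bB; apply: indepS hJB; apply: setSU.
Qed.

Fact contract_indep_aug C I J :
  contract_indep C I -> contract_indep C J -> #|I| < #|J| ->
  exists2 e, e \in J :\: I & contract_indep C (e |: I).
Proof.
case/andP=> dI /existsP[B /andP[bB hI]].
case/andP=> dJ /existsP[B' /andP[bB' hJ]] ltIJ.
have [_ sB maxB] := basis_ofP bB; have [_ sB' _] := basis_ofP bB'.
have cU X (A : {set T}) : [disjoint X & C] -> A \subset C -> #|X :|: A| = #|X| + #|A|.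
  by move=> dX sA; apply/eqP; rewrite (leq_card_setU X A); exact: disjointWr sA dX.
have lt : #|I :|: B| < #|J :|: B'|.
  rewrite (cU _ _ dI sB) (cU _ _ dJ sB').
  by rewrite -addSn leq_add // (basis_of_card bB bB').
have [e] := indep_aug hI hJ lt.
rewrite !inE negb_or => /andP[/andP[eI eB] eJB'] heIB.
have eJ : e \in J.
  case/orP: eJB' => // /(subsetP sB') eC; case/negP: eB; apply: maxB => //.
  by apply: indepS heIB; rewrite setUS // subsetUr.
exists e; first by rewrite inE eI.
rewrite /contract_indep -setI_eq0 setIUl setU_eq0 !setI_eq0 dI.
rewrite disjoints1 (disjointFr dJ eJ) /=.
by apply/existsP; exists B; rewrite bB -setUA.
Qed.

Definition contract C : matroid T :=
  @Matroid T (ground M :\: C) (contract_indep C) (@contract_ground C)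
    (@contract_indep0 C) (@contract_indepS C) (@contract_indep_aug C).

End MatroidTheory.

(* The bijection is between the ground sets as subtypes: a map between the
   ambient types need not exist when the target one is empty. *)
Definition isomorphic (T1 T2 : finType) (M1 : matroid T1) (M2 : matroid T2)
    : Prop :=
  exists2 f : {x : T1 | x \in ground M1} -> {y : T2 | y \in ground M2},
    bijective f &
    forall X : {set {x : T1 | x \in ground M1}},
      indep M1 (val @: X) = indep M2 (val @: (f @: X)).

(* A loop is an edge with a single end. *)
Record graph := Graph {
  vertex : finType;
  edge : finType;
  ends : edge -> {set vertex};
  ends_card : forall e, 0 < #|ends e| <= 2
}.

Section Bicircular.
Variable G : graph.
Implicit Types (W : {set vertex G}) (F A B C I J : {set edge G}).

Definition subgraph W F : bool := [forall e in F, ends e \subset W].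

Definition bicycle W F : bool :=
  [&& subgraph W F, #|W| < #|F| &
   [forall W' : {set vertex G}, forall F' : {set edge G},
      [&& subgraph W' F', W' \subset W, F' \subset F & #|W'| < #|F'|]
      ==> (W' == W) && (F' == F)]].

Definition bicycle_edges F : bool := [exists W, bicycle W F].

Definition bicircular_indep : pred {set edge G} :=
  fun I => ~~ [exists C, bicycle_edges C && (C \subset I)].

Definition span F : {set vertex G} := \bigcup_(e in F) ends e.

Lemma subgraphE W F : subgraph W F = (span F \subset W).
Proof.
apply/forall_inP/bigcupsP => h e eF; exact: h.
Qed.

Lemma spanS A B : A \subset B -> span A \subset span B.
Proof.
move=> sAB; apply/bigcupsP => e eA; apply: bigcup_sup.
exact: (subsetP sAB).
Qed.

Lemma bicycle_edgesE F :
  bicycle_edges F = minset (fun A => #|span A| < #|A|) F.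
Proof.
apply/existsP/minsetP => [[W /and3P[]]|[ltF minF]].
  rewrite subgraphE => sFW ltW /forallP minW; split.
    exact: leq_ltn_trans (subset_leq_card sFW) ltW.
  move=> A ltA sAF; apply/eqP.
  have /forallP/(_ A)/implyP := minW (span A).
  rewrite subgraphE subxx (subset_trans (spanS sAF) sFW) sAF ltA.
  by case/(_ isT)/andP.
exists (span F); rewrite /bicycle subgraphE subxx ltF /=.
apply/forallP => W; apply/forallP => A; apply/implyP.
rewrite subgraphE => /and4P[sAW sWF sAF ltW].
have eAF : A = F.
  by apply: minF => //; apply: leq_ltn_trans (subset_leq_card sAW) ltW.
by rewrite eAF eqxx andbT eqEsubset sWF -eAF.
Qed.

Lemma bicircular_indepP I :
  reflect (forall A, A \subset I -> #|A| <= #|span A|) (bicircular_indep I).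
Proof.
apply: (iffP idP) => [/existsPn noC A sAI | cI].
  rewrite leqNgt; apply/negP => ltA.
  have [C mC sCA] := minset_exists (P := fun A => #|span A| < #|A|) ltA.
  have := noC C; rewrite bicycle_edgesE [minset _ _]mC /=.
  by rewrite (subset_trans sCA sAI).
apply/existsPn => C; apply/negP => /andP[]; rewrite bicycle_edgesE.
by move=> /minsetp ltC /cI; rewrite leqNgt ltC.
Qed.

Fact bicircular_indep0 : bicircular_indep set0.
Proof.
by apply/bicircular_indepP => A; rewrite subset0 => /eqP->; rewrite cards0.
Qed.

Fact bicircular_indepS I J :
  I \subset J -> bicircular_indep J -> bicircular_indep I.
Proof.
move=> sIJ /bicircular_indepP cJ; apply/bicircular_indepP => A sAI.
exact: cJ (subset_trans sAI sIJ).
Qed.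

Lemma spanU A B : span (A :|: B) = span A :|: span B.
Proof. exact: bigcup_setU. Qed.

(* Sets with as many edges as vertices inside an independent set are closed
   under union, since the number of spanned vertices is submodular. *)
Lemma tightU I A B :
  bicircular_indep I -> A \subset I -> B \subset I ->
  #|span A| <= #|A| -> #|span B| <= #|B| ->
  #|span (A :|: B)| <= #|A :|: B|.
Proof.
move=> /bicircular_indepP cI sA sB tA tB.
have cAB := cI (A :&: B) (subset_trans (subsetIl _ _) sA).
have sI : #|span (A :&: B)| <= #|span A :&: span B|.
  by rewrite subset_leq_card // subsetI !spanS ?subsetIl ?subsetIr.
have e1 := cardsUI A B; have e2 := cardsUI (span A) (span B).
rewrite spanU -(leq_add2r #|span A :&: span B|) e2.
apply: leq_trans (leq_add tA tB) _; rewrite -e1 leq_add2l.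
exact: leq_trans cAB sI.
Qed.

Fact bicircular_indep_aug I J :
  bicircular_indep I -> bicircular_indep J -> #|I| < #|J| ->
  exists2 e, e \in J :\: I & bicircular_indep (e |: I).
Proof.
move=> hI /bicircular_indepP cJ ltIJ; have /bicircular_indepP cI := hI.
case: (pickP [pred e | (e \in J :\: I) && bicircular_indep (e |: I)]).
  by move=> e /andP[? ?]; exists e.
move=> noaug; exfalso; move: ltIJ; apply/negP; rewrite -leqNgt.
have tight e : e \in J :\: I ->
  exists A, [/\ A \subset I, #|span A| <= #|A| & ends e \subset span A].
  move=> eJI; have := noaug e; rewrite /= eJI /= => /negbT/negbNE/existsP[C].
  case/andP; rewrite bicycle_edgesE => /minsetp ltC sCI.
  have eC : e \in C.
    apply: contraTT ltC => eC; rewrite -leqNgt; apply: cI.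
    apply/subsetP => x xC; have := subsetP sCI x xC; rewrite !inE.
    by case/orP=> // /eqP ex; rewrite -ex xC in eC.
  have sC'I : C :\ e \subset I by rewrite subDset.
  have leC : #|span C| <= #|C :\ e| by move: ltC; rewrite (cardsD1 e C) eC.
  have sp : span (C :\ e) \subset span C by apply: spanS; apply: subD1set.
  exists (C :\ e); split=> //.
    exact: leq_trans (subset_leq_card sp) leC.
  have /eqP-> : span (C :\ e) == span C.
    by rewrite eqEcard sp (leq_trans leC) ?cI.
  exact: bigcup_sup.
pose tgt A := (A \subset I) && (#|span A| <= #|A|).
pose U := \bigcup_(A | tgt A) A.
have tgtU : tgt U.
  rewrite /U; elim/big_ind: _ => [|A B /andP[sA tA] /andP[sB tB]|A] //.
    by rewrite /tgt sub0set /span big_set0 cards0.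
  by rewrite /tgt subUset sA sB (tightU hI).
have /andP[sUI tU] := tgtU.
have sJU : span (J :\: I) \subset span U.
  apply/bigcupsP => e /tight[A [sA tA sE]]; apply: subset_trans sE _.
  by apply: spanS; apply: bigcup_sup; rewrite /tgt sA.
pose K := J :&: (U :|: (J :\: I)).
have sK : span K \subset span U.
  apply: subset_trans (spanS (subsetIr _ _)) _.
  by rewrite spanU subUset subxx.
have leK : #|K| <= #|U|.
  apply: leq_trans (cJ K (subsetIl _ _)) _.
  exact: leq_trans (subset_leq_card sK) tU.
have sJ : J \subset K :|: (I :\: U).
  apply/subsetP => x xJ; rewrite !inE xJ /=.
  by case: (x \in U); case: (x \in I).
apply: leq_trans (subset_leq_card sJ) _.
apply: leq_trans (leq_card_setU _ _) _.
by rewrite -(cardsID U I) (setIidPr sUI) leq_add2r.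
Qed.

Definition bicircular_matroid : matroid (edge G) :=
  @Matroid (edge G) [set: edge G] bicircular_indep (fun I _ => subsetT I)
    bicircular_indep0 bicircular_indepS bicircular_indep_aug.

Lemma circuit_bicircular C :
  circuit bicircular_matroid C = bicycle_edges C.
Proof.
apply/minsetP/idP => /= [[]|bC].
  rewrite subsetT /= => /negbNE/existsP[D /andP[bD sDC]] minC.
  rewrite -(minC D) //; rewrite subsetT negbK.
  by apply/existsP; exists D; rewrite bD subxx.
split; first by rewrite subsetT negbK; apply/existsP; exists C; rewrite bC subxx.
move=> A; rewrite subsetT negbK => /existsP[D /andP[bD sDA]] sAC.
apply/eqP; rewrite eqEsubset sAC /=.
move: bC bD; rewrite !bicycle_edgesE => /minsetP[_ minC] /minsetp ltD.
by rewrite -(minC D ltD (subset_trans sDA sAC)).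
Qed.

End Bicircular.

Definition bicircular (T : finType) (M : matroid T) : Prop :=
  exists G : graph, isomorphic (delete M (loops M)) (bicircular_matroid G).

Definition excluded_minor (T : finType) (N : matroid T) : Prop :=
  ~ bicircular N /\
  forall C D : {set T},
    C \subset ground N -> D \subset ground N -> [disjoint C & D] ->
    C :|: D != set0 ->
    bicircular (delete (contract N C) D).

(* Main.v *)
Require Import Defs.
From mathcomp Require Import all_boot zify.

(* The key fact is that an excluded minor [N] has no [U_{2,4}]-restriction.
   Let [L] be such a line and [f] in [L].  In a graph [G] with
   [B(G) = N \ f] three elements of [L - f] lie on two vertices, so one of
   them, [g], is a link between these.  Adding [f] to [G] in parallel with [g]
   cannot represent [N]; comparing the two matroids yields an independent set
   [I_f] whose closure in [N] meets [L] in [f] only.  But a set spanning the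
   link [g] in [B(G)] spans both ends of [g], hence the rest of [L - f], which
   contradicts the existence of [I_g].
   Moreover [N] is loopless with parallel classes of size at most two.  So in
   a graph representing [N \ e] any two vertices are joined by at most three
   links, by at most one if both carry loops, and each vertex carries at most
   two loops.  Elements outside the edges induced by the span of the largest
   tight subset of a basis are coloops, so at most [r] vertices matter. *)

Set Implicit Arguments.
Unset Strict Implicit.
Unset Printing Implicit Defensive.

(** * Bicircular independence as Hall's condition on edge ends *)

Section Hall.
Variables (T V : finType).
Implicit Types (ends : T -> {set V}) (A B I J S : {set T}) (x y z : T).

Definition cov ends A : {set V} := \bigcup_(x in A) ends x.

(** Hall's condition for choosing distinct ends for the edges of [I]; compare
    [bicircular_indepP]. *)
Definition hall ends I : bool :=
  [forall A : {set T}, (A \subset I) ==> (#|A| <= #|cov ends A|)].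

Lemma hallP ends I :
  reflect (forall A, A \subset I -> #|A| <= #|cov ends A|) (hall ends I).
Proof.
apply: (iffP forallP) => [h A sA|h A]; first exact: (implyP (h A)).
by apply/implyP; apply: h.
Qed.

Lemma covS ends A B : A \subset B -> cov ends A \subset cov ends B.
Proof.
move=> sAB; apply/bigcupsP => x xA; apply: bigcup_sup.
exact: (subsetP sAB).
Qed.

Lemma covU ends A B : cov ends (A :|: B) = cov ends A :|: cov ends B.
Proof. exact: bigcup_setU. Qed.

Lemma cov1 ends x : cov ends [set x] = ends x.
Proof. by rewrite /cov big_set1. Qed.

Lemma covU1 ends x A : cov ends (x |: A) = ends x :|: cov ends A.
Proof. by rewrite covU cov1. Qed.

Lemma hallS ends I J : I \subset J -> hall ends J -> hall ends I.
Proof.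
by move=> sIJ /hallP h; apply/hallP => A sA; apply: h (subset_trans sA sIJ).
Qed.

Lemma eq_cov ends ends' A :
  {in A, ends =1 ends'} -> cov ends A = cov ends' A.
Proof. by move=> h; apply: eq_bigr. Qed.

Lemma eq_hall ends ends' I :
  {in I, ends =1 ends'} -> hall ends I = hall ends' I.
Proof.
move=> h; apply: eq_forallb => A; apply: implyb_id2l => sA.
by rewrite (@eq_cov _ ends') // => x /(subsetP sA)/h.
Qed.

(** A violating set contains [x]. Removing [x] from it loses no covered vertex, because [I]
    satisfies Hall's condition; so the rest is tight and still covers [ends x]. *)
Lemma hall_tight ends I x :
  hall ends I -> x \notin I -> ~~ hall ends (x |: I) ->
  exists A, [/\ A \subset I, #|cov ends A| <= #|A| & ends x \subset cov ends A].
Proof.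
move=> /hallP hI xI /forallPn[A]; rewrite negb_imply -ltnNge => /andP[sA ltA].
have xA : x \in A.
  apply: contraTT ltA => xA; rewrite -leqNgt; apply: hI.
  apply/subsetP => y yA; have := subsetP sA y yA; rewrite !inE.
  by case/orP=> // /eqP yx; rewrite -yx yA in xA.
have sA'I : A :\ x \subset I by rewrite subDset.
have leA : #|cov ends A| <= #|A :\ x| by move: ltA; rewrite (cardsD1 x A) xA.
have sp : cov ends (A :\ x) \subset cov ends A by apply: covS; apply: subD1set.
exists (A :\ x); split=> //; first exact: leq_trans (subset_leq_card sp) leA.
have /eqP-> : cov ends (A :\ x) == cov ends A.
  by rewrite eqEcard sp (leq_trans leA) ?hI.
exact: bigcup_sup.
Qed.

(** Converse of [hall_tight]: [x] adds an edge to [A] but no vertex. *)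
Lemma tight_nhall ends I A x :
  A \subset I -> #|cov ends A| <= #|A| -> ends x \subset cov ends A ->
  x \notin I -> ~~ hall ends (x |: I).
Proof.
move=> sA tA sx xI; apply/hallP => /(_ (x |: A) (setUS _ sA)).
rewrite covU1 (setUidPr sx) cardsU1 leqNgt.
by rewrite (contra (subsetP sA x) xI) /= add1n ltnS tA.
Qed.

(** The number of covered vertices is submodular, and Hall's condition holds for [A :&: B]. *)
Lemma hall_tightU ends I A B :
  hall ends I -> A \subset I -> B \subset I ->
  #|cov ends A| <= #|A| -> #|cov ends B| <= #|B| ->
  #|cov ends (A :|: B)| <= #|A :|: B|.
Proof.
move=> /hallP hI sA sB tA tB.
have cAB := hI (A :&: B) (subset_trans (subsetIl _ _) sA).
have sI : #|cov ends (A :&: B)| <= #|cov ends A :&: cov ends B|.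
  by rewrite subset_leq_card // subsetI !covS ?subsetIl ?subsetIr.
have e1 := cardsUI A B; have e2 := cardsUI (cov ends A) (cov ends B).
rewrite covU; lia.
Qed.

(* An element with the ends of [y] behaves like [y] as long as [y] is absent. *)
Lemma hall_twin ends x y I :
  x \notin I -> y \notin I -> ends x = ends y ->
  hall ends (x |: I) -> hall ends (y |: I).
Proof.
move=> xI yI exy /hallP h; apply/hallP => A sA.
have sAy : A :\ y \subset I by rewrite subDset.
have [yA|yA] := boolP (y \in A); last first.
  have <- : A :\ y = A by apply/setDidPl; rewrite disjoint_sym disjoints1.
  exact: h (subset_trans sAy (subsetUr _ _)).
have := h (x |: A :\ y) (setUS _ sAy).
rewrite covU1 exy -covU1 setD1K // cardsU1.
by rewrite (contra (subsetP sAy x) xI) (cardsD1 y A) yA.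
Qed.

Lemma hall1 ends x : 0 < #|ends x| -> hall ends [set x].
Proof.
move=> x0; apply/hallP => A; rewrite subset1 => /orP[]/eqP->.
  by rewrite cov1 cards1.
by rewrite cards0.
Qed.

Lemma hall2 ends x y : x != y -> 0 < #|ends x| -> 0 < #|ends y| ->
  hall ends [set x; y] = (1 < #|ends x :|: ends y|).
Proof.
move=> xy x0 y0; apply/idP/idP => [/hallP/(_ _ (subxx _))|].
  by rewrite covU !cov1 cards2 xy.
apply: contraTT => nh; have xy1 : x \notin [set y] by rewrite inE.
have [A [sA tA sx]] := hall_tight (hall1 y0) xy1 nh.
move: sA; rewrite subset1 => /orP[]/eqP eA; move: tA sx; rewrite {}eA.
  by rewrite cov1 cards1 => y1 /setUidPr->; rewrite -leqNgt.
by rewrite /cov big_set0 subset0 -cards_eq0 => _ /eqP x00; rewrite x00 in x0.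
Qed.

(** A tight subset of [[set y; z]] covers [ends x]. Pairwise independence excludes subsets of at
    most one element, so it is all of [[set y; z]]. *)
Lemma nhall3 ends x y z :
  x != y -> x != z -> hall ends [set x; y] -> hall ends [set x; z] ->
  hall ends [set y; z] -> ~~ hall ends [set x; y; z] ->
  #|ends x :|: ends y :|: ends z| <= 2.
Proof.
move=> xy xz hxy hxz hyz; rewrite -setUA => nh.
have xyz : x \notin [set y; z] by rewrite !inE negb_or xy.
have [A [sA tA sx]] := hall_tight hyz xyz nh.
have noA w : x != w -> hall ends [set x; w] -> A \subset [set w] -> False.
  move=> xw hxw sAw; have xw1 : x \notin [set w] by rewrite inE.
  by have := tight_nhall sAw tA sx xw1; rewrite hxw.
have zA : z \in A.
  apply/negPn/negP => zA; apply: (noA y xy hxy).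
  have sA' : A \subset [set y; z] :\ z by rewrite subsetD1 sA zA.
  apply: subset_trans sA' _; apply/subsetP => w; rewrite !inE.
  by case/andP=> /negPf->; rewrite ?orbF.
have yA : y \in A.
  apply/negPn/negP => yA; apply: (noA z xz hxz).
  have sA' : A \subset [set y; z] :\ y by rewrite subsetD1 sA yA.
  apply: subset_trans sA' _; apply/subsetP => w; rewrite !inE.
  by case/andP=> /negPf->; rewrite ?orbF.
have eA : A = [set y; z] by apply/eqP; rewrite eqEsubset sA subUset !sub1set yA.
move: tA sx; rewrite eA covU !cov1 => tA sx; rewrite -setUA (setUidPr sx).
by apply: leq_trans tA _; rewrite cards2; case: (_ != _).
Qed.

(* [P] restricted to [S] is the independence predicate of the bicircular matroid
   of the graph with edge set [S]; values of [ends] outside [S] are junk. *)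
Definition represents ends (P : pred {set T}) S : Prop :=
  (forall x, x \in S -> 0 < #|ends x| <= 2) /\
  (forall I, I \subset S -> P I = hall ends I).

End Hall.

(** * Closure and parallel elements in a matroid *)

Section MatroidFacts.
Variables (T : finType) (N : matroid T).
Implicit Types (A B I J K L : {set T}) (x y z : T).

Lemma indep_extend I J :
  indep N I -> indep N J -> #|I| <= #|J| ->
  exists K, [/\ indep N K, I \subset K, K \subset I :|: J & #|K| = #|J|].
Proof.
have [n] := ubnP (#|J| - #|I|); elim: n I => // n IHn I ltn hI hJ.
rewrite leq_eqVlt => /orP[/eqP eIJ|ltIJ].
  by exists I; rewrite subxx subsetUl.
have [e] := indep_aug hI hJ ltIJ; rewrite inE => /andP[eI eJ] heI.
have cI : #|e |: I| = #|I|.+1 by rewrite cardsU1 eI.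
have [||K [hK sK sKJ cK]] := IHn (e |: I) _ heI hJ; rewrite ?cI //; first lia.
exists K; split=> //; first exact: subset_trans (subsetUr _ _) sK.
by apply: subset_trans sKJ _; rewrite -setUA subUset sub1set inE eJ orbT /=.
Qed.

(* For independent [I], this says that [x] is in the closure of [I]. *)
Definition spans I x : bool := (x \in I) || ~~ indep N (x |: I).

(** If [z] is not spanned, [[set x; y]] extends by elements of [z |: I] to an independent [K] larger
    than [I]. As [K] misses [z], augmenting [I] from [K] adds [x] or [y], although both are
    spanned. *)
Lemma spans_line I x y z :
  indep N I -> indep N [set x; y] -> ~~ indep N [set x; y; z] ->
  spans I x -> spans I y -> spans I z.
Proof.
move=> hI hxy dxyz sx sy; apply: contraT; rewrite negb_or negbK => /andP[zI hzI].
(* This could fail only for empty [I], which does not span the non-loop [x]. *)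
have xy2 : #|[set x; y]| <= #|z |: I|.
  rewrite leqNgt; apply/negP => lt.
  have I0 : I = set0.
    by apply/eqP; rewrite -cards_eq0; move: lt; rewrite cardsU1 zI cards2; lia.
  move: sx; rewrite /spans I0 inE setU0 /= => /negP; apply.
  by apply: indepS hxy; rewrite sub1set !inE eqxx.
have [K [hK sK sKI cK]] := indep_extend hxy hzI xy2.
have zK : z \notin K.
  apply: contra dxyz => zK; apply: indepS hK.
  by rewrite subUset sK sub1set.
have [|k] := indep_aug hI hK; first by rewrite cK cardsU1 zI.
rewrite inE => /andP[kI kK] hk.
have := subsetP sKI k kK; rewrite !inE (negPf kI) orbF.
have /negPf-> : k != z by apply: contraNneq zK => <-.
rewrite orbF => /orP[]/eqP ek; move: hk kI; rewrite ek => hk kI.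
  by move: sx; rewrite /spans hk (negPf kI).
by move: sy; rewrite /spans hk (negPf kI).
Qed.

(** Extending [[set y]] from [x |: I] to the same size cannot use [x], so it gives [y |: I]. *)
Lemma parallel_swap I x y :
  indep N [set y] -> ~~ indep N [set x; y] -> x \notin I -> y \notin I ->
  indep N (x |: I) -> indep N (y |: I).
Proof.
move=> hy dxy xI yI hxI.
have [|K [hK sK sKI cK]] := indep_extend hy hxI.
  by rewrite cards1 cardsU1 xI.
have xK : x \notin K.
  apply: contra dxy => xK; apply: indepS hK.
  by rewrite subUset sK sub1set xK.
suff <- : K = y |: I by [].
apply/eqP; rewrite eqEcard cK !cardsU1 xI yI leqnn andbT.
apply/subsetP => k kK; have := subsetP sKI k kK; rewrite !inE.
by have /negPf-> : k != x by apply: contraNneq xK => <-.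
Qed.

Lemma mem_loops x : (x \in loops N) = (x \in ground N) && ~~ indep N [set x].
Proof.
rewrite inE; apply/idP/idP => [/minsetp|h]; first by rewrite sub1set.
apply/minsetP; rewrite sub1set; split=> // B /andP[_ dB].
by rewrite subset1 => /orP[/eqP//|/eqP B0]; rewrite B0 indep0 in dB.
Qed.

Lemma basis_of0 : basis_of N set0 set0.
Proof.
apply/maxsetP; rewrite indep0 subxx; split=> // B /andP[_].
by rewrite subset0 => /eqP.
Qed.

Lemma indep_contract0 I : indep (contract N set0) I = indep N I.
Proof.
rewrite /= /contract_indep -setI_eq0 setI0 eqxx /=.
apply/existsP/idP => [[B /andP[/basis_ofP[_ sB _]]]|hI].
  by move: sB; rewrite subset0 => /eqP->; rewrite setU0.
by exists set0; rewrite basis_of0 setU0.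
Qed.

End MatroidFacts.

(** * Bicircularity as an assignment of ends to matroid elements *)

Lemma subset_imset (aT rT : finType) (f : aT -> rT) (X : {set aT})
    (A : {set rT}) :
  A \subset f @: X -> exists2 B : {set aT}, B \subset X & A = f @: B.
Proof.
move=> sA; exists (X :&: f @^-1: A); first exact: subsetIl.
apply/setP => y; apply/idP/imsetP => [yA|[u]]; last first.
  by rewrite !inE => /andP[_ ?] ->.
have /imsetP[u uX yu] := subsetP sA y yA.
by exists u; rewrite ?inE ?uX -?yu.
Qed.

(** Ends are pulled back along the isomorphism, so that later arguments stay in [T] and avoid
    subtypes. *)
Lemma bicircular_represents (T : finType) (M : matroid T) :
  bicircular M ->
  exists (V : finType) (ends : T -> {set V}),
    represents ends (indep M) (ground M :\: loops M).
Proof.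
case=> G [f /bij_inj injf hf]; exists (vertex G).
pose S := ground M :\: loops M; pose sT := {x : T | x \in S}.
pose phi (u : sT) := val (f u).
(* [set0] is a default value outside [S]. *)
pose en x := if insub x is Some u then ends (phi (u : sT)) else set0.
have enE (u : sT) : en (val u) = ends (phi u) by rewrite /en valK.
have phiI : injective phi by move=> u v /val_inj/injf.
exists en; split=> [x xS|I sI].
  by have := ends_card (phi (Sub x xS)); rewrite -enE.
have subE (A : {set T}) : A \subset S -> A = val @: [set u : sT | val u \in A].
  move=> sA; apply/setP => x; apply/idP/imsetP => [xA|[u]].
    by exists (Sub x (subsetP sA x xA)); rewrite ?inE.
  by rewrite inE => ? ->.
have dI : [disjoint I & loops M].
  by move: sI; rewrite subsetD => /andP[].
have spE (A : {set sT}) : span (phi @: A) = cov en (val @: A).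
  rewrite /span /cov; apply/setP => v.
  apply/bigcupP/bigcupP => [[_ /imsetP[u uA ->] h]|[_ /imsetP[u uA ->] h]].
    by exists (val u); rewrite ?imset_f ?enE.
  by exists (phi u); rewrite ?imset_f -?enE.
have -> : indep M I = bicircular_indep (phi @: [set u : sT | val u \in I]).
  have := hf [set u : sT | val u \in I].
  rewrite -subE //= /delete_indep dI andbT => ->.
  by rewrite -imset_comp.
apply/bicircular_indepP/hallP => h A sA.
  have sAS := subset_trans sA sI.
  rewrite (subE A sAS) -spE (card_imset _ val_inj) -(card_imset _ phiI).
  apply: h; apply: imsetS; apply/subsetP => u.
  by rewrite !inE => /(subsetP sA).
have [B sB ->] := subset_imset sA.
rewrite spE card_imset // -(card_imset B val_inj); apply: h.
by rewrite (subE I sI); apply: imsetS.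
Qed.

Lemma represents_bicircular (T V : finType) (M : matroid T)
    (en : T -> {set V}) :
  represents en (indep M) (ground M :\: loops M) -> bicircular M.
Proof.
case=> hcard hind; pose S := ground M :\: loops M; pose sT := {x : T | x \in S}.
pose G := Graph (fun u : sT => hcard (val u) (valP u)).
exists G; exists (fun u : sT => exist _ u (in_setT u) :
   {y : edge G | y \in ground (bicircular_matroid G)}).
  exists (fun y => val y) => [u|y] //; exact: val_inj.
move=> X.
have -> : val @: ((fun u : sT => exist _ u (in_setT u) :
   {y : edge G | y \in ground (bicircular_matroid G)}) @: X) = X.
  by rewrite -imset_comp; apply: imset_id.
have sX : val @: X \subset S by apply/subsetP => _ /imsetP[u _ ->]; apply: valP.
have dX : [disjoint val @: X & loops M].
  by move: sX; rewrite subsetD => /andP[].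
rewrite /= /delete_indep dX andbT hind //.
have spE (A : {set sT}) : cov en (val @: A) = @span G A.
  rewrite /span /cov; apply/setP => v.
  apply/bigcupP/bigcupP => [[_ /imsetP[u uA ->] h]|[u uA h]]; first by exists u.
  by exists (val u) => //; apply: imset_f.
apply/hallP/bicircular_indepP => h A sA.
  rewrite -spE -(card_imset A val_inj); apply: h; exact: imsetS.
have [B sB ->] := subset_imset sA.
rewrite spE (card_imset _ val_inj); exact: h.
Qed.

(** Sets avoiding [x] have the same status in the minor and in [M], so the loops other than [x]
    agree. Contracting [set0] only matches the shape of [excluded_minor]. *)
Lemma delete_represents (T : finType) (M : matroid T) x :
  bicircular (delete (contract M set0) [set x]) ->
  exists (V : finType) (ends : T -> {set V}),
    represents ends (indep M) ((ground M :\: loops M) :\ x).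
Proof.
set M' := delete _ _; have gM' : ground M' = ground M :\ x by rewrite /= setD0.
case/bicircular_represents=> V [ends [hcard hind]]; exists V, ends.
have indE (I : {set T}) : x \notin I -> indep M' I = indep M I.
  move=> xI; rewrite /= /delete_indep disjoint_sym disjoints1 xI andbT.
  exact: indep_contract0.
have gE : ground M' :\: loops M' = (ground M :\: loops M) :\ x.
  apply/setP => y; rewrite in_setD mem_loops gM' !in_setD1 in_setD mem_loops.
  have [->|yx] := eqVneq y x; first by rewrite andbF.
  have xy : x \notin [set y] by rewrite in_set1 eq_sym.
  by rewrite (indE _ xy).
rewrite -gE; split=> // I sI; rewrite -hind ?indE //.
by apply/negP => /(subsetP sI); rewrite gE !inE eqxx.
Qed.

(** * Loops and parallel classes of an excluded minor *)

Section ExcludedMinor.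
Variables (T : finType) (N : matroid T) (hN : excluded_minor N).
Implicit Types (A B I J K L : {set T}) (x y z : T).

Lemma excluded_minor_delete x :
  x \in ground N -> bicircular (delete (contract N set0) [set x]).
Proof.
move=> xN; case: hN => _; apply; rewrite ?sub0set ?sub1set //.
  by rewrite -setI_eq0 set0I.
by rewrite set0U -card_gt0 cards1.
Qed.

(** Deleting a loop keeps the non-loops, so a graph of the deletion would represent [N]. *)
Lemma excluded_minor_loopless : loops N = set0.
Proof.
case: (set_0Vmem (loops N)) => // -[x xl]; case: hN => nb _; case: nb.
have xN : x \in ground N by move: xl; rewrite mem_loops => /andP[].
have [V [ends]] := delete_represents (excluded_minor_delete xN).
have -> : (ground N :\: loops N) :\ x = ground N :\: loops N.
  by apply/setDidPl; rewrite disjoint_sym disjoints1 inE xl.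
exact: represents_bicircular.
Qed.

Lemma excluded_minor_represents x : x \in ground N ->
  exists (V : finType) (ends : T -> {set V}),
    represents ends (indep N) (ground N :\ x).
Proof.
move=> xN; have := delete_represents (excluded_minor_delete xN).
by rewrite excluded_minor_loopless setD0.
Qed.

Lemma excluded_minor_nrepresents (V : finType) (ends : T -> {set V}) :
  ~ represents ends (indep N) (ground N).
Proof.
rewrite -[ground N]setD0 -excluded_minor_loopless => /represents_bicircular.
by case: hN.
Qed.

Lemma excluded_minor_indep1 x : x \in ground N -> indep N [set x].
Proof.
move=> xN; have : x \notin loops N by rewrite excluded_minor_loopless inE.
by rewrite mem_loops xN negbK.
Qed.

(* As [N] is not bicircular, adding [x] to a graph of [N \ x] as an edge with
   ends [E] must fail, whatever [E] is. *)
Lemma represents_add (V : finType) (ends : T -> {set V}) x (E : {set V}) :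
  x \in ground N -> represents ends (indep N) (ground N :\ x) ->
  0 < #|E| <= 2 ->
  exists I, [/\ I \subset ground N :\ x, indep N I &
    indep N (x |: I) != hall (fun y => if y == x then E else ends y) (x |: I)].
Proof.
set ends' := fun y => _; move=> xN [hcard hind] hE.
have eqe I : x \notin I -> hall ends' I = hall ends I.
  move=> xI; apply: eq_hall => y yI; rewrite /ends' ifN //.
  by apply: contraNneq xI => <-.
pose bad I := [&& I \subset ground N :\ x, indep N I &
  indep N (x |: I) != hall ends' (x |: I)].
case: (pickP bad) => [I /and3P[]|nobad]; first by exists I.
case: (@excluded_minor_nrepresents V ends'); split=> [y yN|I sI].
  by rewrite /ends'; case: eqVneq => // yx; apply: hcard; rewrite !inE yx.
have [xI|xI] := boolP (x \in I); last by rewrite eqe ?hind // subsetD1 sI.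
have sI' : I :\ x \subset ground N :\ x by apply: setSD.
have xI' : x \notin I :\ x by rewrite !inE eqxx.
have := nobad (I :\ x); rewrite /bad sI' setD1K //=.
(* If [I :\ x] is dependent, then so is [I], both in [N] and in the graph. *)
case: (boolP (indep N (I :\ x))) => [_ /negbFE/eqP//|nI _].
have /negPf-> : ~~ indep N I by apply: contra nI; apply: indepS; apply: subD1set.
symmetry; apply: contraNF nI; rewrite hind // -eqe //.
by apply: hallS; apply: subD1set.
Qed.

(** In a graph of [N \ z], [x] and [y] are loops at one vertex; adding [z] as a third loop there
    would represent [N]. *)
Lemma excluded_minor_parallel_le2 x y z :
  x \in ground N -> y \in ground N -> z \in ground N ->
  x != y -> x != z -> y != z ->
  ~~ indep N [set x; y] -> ~~ indep N [set x; z] -> False.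
Proof.
move=> xN yN zN xy xz yz dxy dxz.
have [V [ends hrep]] := excluded_minor_represents zN.
have [hcard hind] := hrep.
have xS : x \in ground N :\ z by rewrite !inE xz.
have yS : y \in ground N :\ z by rewrite !inE yz.
have exy : #|ends x :|: ends y| <= 1.
  have := dxy; rewrite hind; last by rewrite subUset !sub1set xS.
  have [/andP[ex0 _] /andP[ey0 _]] := (hcard x xS, hcard y yS).
  by rewrite hall2 // -leqNgt.
have [|I [sI hI]] := represents_add zN hrep (E := ends x); first exact: hcard.
set ends' := fun y => _.
have zI : z \notin I by apply/negP => /(subsetP sI); rewrite !inE eqxx.
have eqe J : z \notin J -> hall ends' J = hall ends J.
  move=> zJ; apply: eq_hall => w wJ; rewrite /ends' ifN //.
  by apply: contraNneq zJ => <-.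
have e'z : ends' z = ends' x by rewrite /ends' eqxx (negPf xz).
have e'x : ends' x = ends x by rewrite /ends' (negPf xz).
have [xI|xI] := boolP (x \in I).
  have /negPf-> : ~~ indep N (z |: I).
    apply: contra dxz; apply: indepS.
    by rewrite subUset !sub1set !inE eqxx xI orbT.
  have /negPf-> // : ~~ hall ends' (z |: I).
  apply/hallP => /(_ [set x; z]).
  rewrite covU !cov1 e'z setUid e'x cards2 xz /= => h.
  have := leq_trans (h _) (leq_trans (subset_leq_card (subsetUl _ _)) exy).
  by rewrite subUset !sub1set !inE eqxx xI orbT => /(_ isT).
have zxI : z \notin x |: I by rewrite !inE negb_or zI eq_sym xz.
(* Now [z] can be traded for [x] on both sides, and [x |: I] avoids [z], so the given graph decides
   it correctly. *)
have -> : indep N (z |: I) = indep N (x |: I).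
  apply/idP/idP; apply: parallel_swap => //; rewrite ?excluded_minor_indep1 //.
  by rewrite setUC.
have -> : hall ends' (z |: I) = hall ends' (x |: I).
  by apply/idP/idP; apply: hall_twin.
by rewrite eqe // hind ?eqxx // subUset sub1set xS.
Qed.


(** * Lines with at least four points *)

Section Line.
Variable L : {set T}.
Hypothesis sLN : L \subset ground N.
Hypothesis L4 : 3 < #|L|.
Hypothesis hL2 : {in L &, forall x y, x != y -> indep N [set x; y]}.
Hypothesis hL3 : {in L & &, forall x y z,
  x != y -> x != z -> y != z -> ~~ indep N [set x; y; z]}.

Lemma spans_in_line I x y z : indep N I -> x \in L -> y \in L -> z \in L ->
  x != y -> spans N I x -> spans N I y -> spans N I z.
Proof.
move=> hI xL yL zL xy sx sy.
have [<-//|xz] := eqVneq x z; have [<-//|yz] := eqVneq y z.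
by apply: spans_line sx sy => //; [apply: hL2 | apply: hL3].
Qed.

(** Three elements of [L :\ f] cover at most two vertices. The ends of one covering both contain
    those of the others; if [x] and [y] are loops, they occupy both vertices, so [z] is nested with
    one of them. *)
Lemma line_nested_ends (V : finType) (ends : T -> {set V}) f :
  f \in L -> represents ends (indep N) (ground N :\ f) ->
  exists g h, [/\ g \in L :\ f, h \in L :\ f, g != h & ends h \subset ends g].
Proof.
move=> fL [hcard hind].
have /card_gt2P[x [y [z [[xL yL zL] [xy yz zx]]]]] : 2 < #|L :\ f|.
  by move: L4; rewrite (cardsD1 f L) fL.
have sLS : L :\ f \subset ground N :\ f by apply: setSD.
have inS w : w \in L :\ f -> w \in ground N :\ f by apply/subsetP.
have inL w : w \in L :\ f -> w \in L by rewrite inE => /andP[].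
have hp v w : v \in L :\ f -> w \in L :\ f -> v != w -> hall ends [set v; w].
  move=> vL wL vw; rewrite -hind ?hL2 ?inL //.
  by rewrite subUset !sub1set !inS.
have xz : x != z by rewrite eq_sym.
have /nhall3 W2 : ~~ hall ends [set x; y; z].
  rewrite -hind ?hL3 ?inL //.
  by rewrite !subUset !sub1set !inS.
have {}W2 := W2 xy xz (hp _ _ xL yL xy) (hp _ _ xL zL xz) (hp _ _ yL zL yz).
have cc w : w \in L :\ f -> 0 < #|ends w| by move/inS/hcard/andP => [].
have hp2 v w : v \in L :\ f -> w \in L :\ f -> v != w ->
    1 < #|ends v :|: ends w|.
  by move=> vL wL vw; rewrite -(hall2 vw) ?cc ?hp.
pose W := ends x :|: ends y :|: ends z.
have full w : 1 < #|ends w| -> ends w \subset W -> ends w = W.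
  move=> w1 wW; apply/eqP; rewrite eqEcard wW; exact: leq_trans W2 w1.
have sxW : ends x \subset W by rewrite /W -setUA subsetUl.
have syW : ends y \subset W by rewrite /W setUAC subsetUr.
have szW : ends z \subset W by rewrite subsetUr.
have [x1|x1] := ltnP 1 #|ends x|.
  by exists x, y; rewrite (full x).
have [y1|y1] := ltnP 1 #|ends y|.
  by exists y, x; rewrite (full y) // eq_sym.
have exyW : ends x :|: ends y = W.
  apply/eqP; rewrite eqEcard subUset sxW syW /=.
  exact: leq_trans W2 (hp2 _ _ xL yL xy).
have /card_gt0P[a az] := cc z zL.
have [z1|z1] := ltnP 1 #|ends z|.
  by exists z, x; rewrite (full z).
have ez : ends z = [set a].
  by apply/eqP; rewrite eq_sym eqEcard sub1set az cards1.
have := subsetP szW a az; rewrite -exyW inE => /orP[]aw.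
  by exists x, z; rewrite ez sub1set.
by exists y, z; rewrite ez sub1set.
Qed.

Lemma line_bad_set f : f \in L ->
  exists I, [/\ I \subset ground N :\ f, indep N I, ~~ indep N (f |: I) &
    forall y, y \in L :\ f -> ~~ spans N I y].
Proof.
move=> fL; have fN := subsetP sLN f fL.
have [V [ends hrep]] := excluded_minor_represents fN; have [hcard hind] := hrep.
have [g [h [gLf hLf gh egh]]] := line_nested_ends fL hrep.
have [gL hL] : g \in L /\ h \in L.
  by move: gLf hLf; rewrite !inE => /andP[_ ?] /andP[_ ?].
have [gf hf] : g != f /\ h != f.
  by move: gLf hLf; rewrite !inE => /andP[? _] /andP[? _].
have gS : g \in ground N :\ f by rewrite !inE gf (subsetP sLN).
have hS : h \in ground N :\ f by rewrite !inE hf (subsetP sLN).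
have [|I [sI hI]] := represents_add fN hrep (E := ends g); first exact: hcard.
set ends' := fun y => _.
have fI : f \notin I by apply/negP => /(subsetP sI); rewrite !inE eqxx.
have e'w w : w != f -> ends' w = ends w by rewrite /ends' => /negPf->.
have eqe J : f \notin J -> {in J, ends' =1 ends}.
  by move=> fJ w wJ; rewrite e'w //; apply: contraNneq fJ => <-.
have e'f : ends' f = ends g by rewrite /ends' eqxx.
have hIe : hall ends I by rewrite -hind.
have hIe' : hall ends' I by rewrite (eq_hall (eqe I fI)).
have indU w : w \in ground N :\ f -> indep N (w |: I) = hall ends (w |: I).
  by move=> wS; rewrite hind // subUset sub1set wS.
(* If [f |: I] is independent in [N] only, a tight subset of [I] covers [ends g], hence [ends h]; so
   [I] spans [g] and [h], and with them [f]. *)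
have [hf'|hf'] := boolP (indep N (f |: I)).
  rewrite eq_sym eqb_id => nh.
  have [A [sA]] := hall_tight hIe' fI nh; rewrite e'f.
  have fA : f \notin A by apply: contra fI; apply: subsetP.
  rewrite (eq_cov (eqe A fA)) => tA sg.
  have sp w : w \in ground N :\ f -> ends w \subset ends g -> spans N I w.
    move=> wS wg; rewrite /spans; case: (boolP (w \in I)) => //= wI.
    by rewrite indU // (tight_nhall sA tA (subset_trans wg sg)).
  have := spans_in_line hI gL hL fL gh (sp g gS (subxx _)) (sp h hS egh).
  by rewrite /spans hf' (negPf fI).
(* Otherwise [f |: I] is independent in the graph only. Spanning some further [y] would make [I]
   span all of [L]. *)
rewrite eq_sym eqbF_neg negbK => hh; exists I; split=> // y yL.
apply/negP => sy.
have sp w : w \in L -> spans N I w.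
  move: yL; rewrite inE => /andP[yf yL] wL.
  apply: (@spans_in_line I y f) => //; first by move: yf; rewrite inE.
  by rewrite /spans hf' orbT.
(* Outside [I], [g] could replace its twin [f], making [g |: I] independent. *)
have gI : g \in I.
  apply/negPn/negP => gI; move: (sp g gL); rewrite /spans (negPf gI) indU //.
  have fgI : f \notin g |: I by rewrite !inE negb_or eq_sym gf.
  rewrite -(eq_hall (eqe _ fgI)) (hall_twin fI gI _ hh) //.
  by rewrite e'f e'w.
(* If [h] is in [I], the three edges [f], [g], [h] cover only [ends g]. *)
have [hI'|hI'] := boolP (h \in I).
  have /hallP/(_ [set f; g; h]) := hh.
  rewrite !covU !cov1 e'f !e'w // setUid (setUidPl egh) => h3.
  have : 2 < #|ends g|.
    apply: leq_trans (h3 _).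
      by rewrite -setUA cardsU1 cards2 !inE negb_or eq_sym gf eq_sym hf gh.
    by rewrite !subUset !sub1set !inE eqxx gI hI' !orbT.
  by rewrite ltnNge; case/andP: (hcard g gS) => _ ->.
move: (sp h hL); rewrite /spans (negPf hI') indU // => nh.
have [A [sA tA sh]] := hall_tight hIe hI' nh.
have sB : g |: A \subset I by rewrite subUset sub1set gI.
have fB : f \notin g |: A by apply: contra fI; apply: subsetP.
(* Both [ends g] and the cover of [A] contain [ends h], so [g] brings at most one new vertex. The
   resulting tight set covers the ends given to [f]. *)
have tB : #|cov ends (g |: A)| <= #|g |: A|.
  have [gA|gA] := boolP (g \in A).
    by rewrite (setUidPr _) ?sub1set.
  rewrite covU1 cardsU1 gA; have := cardsUI (ends g) (cov ends A).
  have : 0 < #|ends g :&: cov ends A|.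
    apply: leq_trans (subset_leq_card (_ : ends h \subset _)).
      by case/andP: (hcard h hS).
    by rewrite subsetI egh.
  case/andP: (hcard g gS) => _; move: tA; clear; lia.
move: tB; rewrite -(eq_cov (eqe _ fB)) => tB.
move: hh; apply/negP; apply: tight_nhall sB tB _ fI.
by rewrite covU1 e'f e'w // subsetUl.
Qed.

Lemma excluded_minor_no_line4 : False.
Proof.
have /card_gt0P[f fL] : 0 < #|L| by apply: leq_trans L4.
have fN := subsetP sLN f fL.
have [V [ends hrep]] := excluded_minor_represents fN; have [hcard hind] := hrep.
have [g [h []]] := line_nested_ends fL hrep.
rewrite !inE => /andP[gf gL] /andP[hf hL] gh egh.
(* The bad set is taken for [g], not [f]. It does not span [f], so it lies in [N \ f], where
   spanning [g] forces spanning [h]. *)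
have [I [sI hI ngI nsp]] := line_bad_set gL.
have := nsp f; rewrite !inE eq_sym gf fL negb_or => /(_ isT)/andP[fI _].
have := nsp h; rewrite !inE eq_sym gh hL negb_or negbK => /(_ isT)/andP[hI' hhI].
have gI : g \notin I by apply/negP => /(subsetP sI); rewrite !inE eqxx.
have sIf w : w \in L -> w != f -> w |: I \subset ground N :\ f.
  move=> wL wf; rewrite subUset sub1set !inE wf (subsetP sLN) //=.
  by rewrite subsetD1 fI (subset_trans sI) // subD1set.
have sIf0 : I \subset ground N :\ f.
  by apply: subset_trans (sIf g gL gf); apply: subsetUr.
have hIe : hall ends I by rewrite -hind.
have nh : ~~ hall ends (g |: I) by rewrite -hind ?sIf.
have [A [sA tA sg]] := hall_tight hIe gI nh.
have := tight_nhall sA tA (subset_trans egh sg) hI'.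
by rewrite -hind ?sIf // hhI.
Qed.

End Line.

(** * Counting edges in a graph of [N \ e] *)

Section Count.
Variables (V : finType) (ends : T -> {set V}) (e : T).
Hypothesis eN : e \in ground N.
Hypothesis hrep : represents ends (indep N) (ground N :\ e).
Implicit Types (X W : {set V}) (u v w : V).

Definition joining W : {set T} := [set x in ground N :\ e | ends x == W].

Lemma ends_gt0 x : x \in ground N :\ e -> 0 < #|ends x|.
Proof. by case: hrep => hcard _ /hcard/andP[]. Qed.

Lemma indep_pair x y : x \in ground N :\ e -> y \in ground N :\ e -> x != y ->
  indep N [set x; y] = (1 < #|ends x :|: ends y|).
Proof.
move=> xS yS xy; case: hrep => _ -> //; last by rewrite subUset !sub1set xS.
by rewrite hall2 ?ends_gt0.
Qed.

(** Three edges with ends in [W] are dependent, so four or more such edges would form a forbidden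
    line. *)
Lemma line_le3 W L : L \subset ground N :\ e -> #|W| <= 2 ->
  (forall x, x \in L -> ends x \subset W) ->
  {in L &, forall x y, x != y -> 1 < #|ends x :|: ends y|} -> #|L| <= 3.
Proof.
move=> sL W2 sW hL; rewrite leqNgt; apply/negP => L4.
have inS x : x \in L -> x \in ground N :\ e by apply/subsetP.
apply: (excluded_minor_no_line4 _ L4).
- by apply: subset_trans sL _; apply: subD1set.
- by move=> x y xL yL xy; rewrite indep_pair ?inS ?hL.
move=> x y z xL yL zL xy xz yz; case: hrep => _ ->; last first.
  by rewrite !subUset !sub1set !inS.
apply/hallP => /(_ _ (subxx _)); rewrite !covU !cov1 leqNgt => /negP; apply.
apply: (@leq_ltn_trans 2).
  by apply: leq_trans W2; apply: subset_leq_card; rewrite !subUset !sW.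
by rewrite -setUA cardsU1 cards2 !inE negb_or xy xz yz.
Qed.

Lemma joining1_le2 v : #|joining [set v]| <= 2.
Proof.
rewrite leqNgt; apply/negP => /card_gt2P[x [y [z [[]]]]].
rewrite !inE => /andP[/andP[xe xN] /eqP ex] /andP[/andP[ye yN] /eqP ey].
move=> /andP[/andP[ze zN] /eqP ez] [xy yz zx].
have xz : x != z by rewrite eq_sym.
apply: (excluded_minor_parallel_le2 xN yN zN) => //.
  by rewrite indep_pair ?inE ?xe ?ye // ex ey setUid cards1.
by rewrite indep_pair ?inE ?xe ?ze // ex ez setUid cards1.
Qed.

(** Links on [W] form a line; when both vertices carry loops, [b] and [c] extend it by two
    points. *)
Lemma joining2_le W : #|W| = 2 ->
  #|joining W| + 2 * [forall v in W, joining [set v] != set0] <= 3.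
Proof.
move=> W2; case: forall_inP => hD; last first.
  rewrite muln0 addn0; apply: (@line_le3 W); rewrite ?W2 //.
  - by apply/subsetP => x; rewrite inE => /andP[].
  - by move=> x; rewrite inE => /andP[_ /eqP->].
  move=> x y; rewrite !inE => /andP[_ /eqP->] /andP[_ /eqP->].
  by rewrite setUid W2.
have /eqP/cards2P[u [v [uv eW]]] := W2.
have /set0Pn[b] : joining [set u] != set0 by apply: hD; rewrite eW !inE eqxx.
rewrite inE => /andP[bS /eqP eb].
have /set0Pn[c] : joining [set v] != set0.
  by apply: hD; rewrite eW !inE eqxx orbT.
rewrite inE => /andP[cS /eqP ec].
have bW : b \notin joining W.
  by rewrite inE bS eb; apply/eqP => bW; move: W2; rewrite -bW cards1.
have cW : c \notin joining W.
  by rewrite inE cS ec; apply/eqP => cW; move: W2; rewrite -cW cards1.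
have bc : b != c.
  apply: contraNneq uv => bc; move: ec; rewrite -bc eb => /setP/(_ u).
  by rewrite !inE eqxx => <-.
have -> : #|joining W| + 2 * true = #|b |: (c |: joining W)|.
  rewrite !cardsU1 cW in_setU1 negb_or bc bW; clear; lia.
apply: (@line_le3 W); rewrite ?W2 //.
- rewrite !subUset !sub1set bS cS.
  by apply/subsetP => x; rewrite inE => /andP[].
- move=> x /setU1P[->|/setU1P[->|]].
  + by rewrite eb eW subsetUl.
  + by rewrite ec eW subsetUr.
  by rewrite inE => /andP[_ /eqP->].
have eJ x : x \in joining W -> ends x = W by rewrite inE => /andP[_ /eqP].
have Wl X : 1 < #|W :|: X| by rewrite -W2; apply/subset_leq_card/subsetUl.
have Wr X : 1 < #|X :|: W| by rewrite setUC.
move=> x y /setU1P[->|/setU1P[->|/eJ->]] /setU1P[->|/setU1P[->|/eJ->]];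
  rewrite ?eqxx ?Wl ?Wr // => _; first by rewrite eb ec -eW W2.
by rewrite setUC eb ec -eW W2.
Qed.

(** If [d] vertices of [X] carry loops, there are at most [2 * d] loops, while the bound on links
    drops by 2 for each of the ['C(d, 2)] pairs of such vertices; [2 * d] exceeds [2 * 'C(d, 2)] by
    at most 3. *)
Lemma spanned_le X :
  #|[set x in ground N :\ e | ends x \subset X]| <= 3 * 'C(#|X|, 2) + 3.
Proof.
set K := [set x in _ | _].
pose D := [set v in X | joining [set v] != set0].
have hK1 : #|[set x in K | #|ends x| == 1]| <= 2 * #|D|.
  apply: (@leq_trans (\sum_(v in D) #|joining [set v]|)); last first.
    by rewrite mulnC -sum_nat_const; apply: leq_sum => v _; apply: joining1_le2.
  pose F := \bigcup_(v in D) joining [set v].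
  apply: (@leq_trans #|F|).
    apply/subset_leq_card/subsetP => x; rewrite inE => /andP[].
    rewrite inE => /andP[xS sx] /cards1P[v ev].
    have xv : x \in joining [set v] by rewrite inE xS ev /=.
    have vX : v \in X by rewrite -sub1set -ev.
    apply/bigcupP; exists v => //; rewrite inE vX.
    by apply/set0Pn; exists x.
  rewrite /F; elim/big_rec2: _ => [|v n F' _ h]; first by rewrite cards0.
  by apply: leq_trans (leq_card_setU _ _) _; rewrite leq_add2l.
pose Q (A : {set V}) := (A \subset X) && (#|A| == 2).
have hK2 : #|[set x in K | #|ends x| == 2]| <= \sum_(A | Q A) #|joining A|.
  rewrite -sum1_card (partition_big ends Q) /=.
    apply: leq_sum => A _; rewrite sum1_card; apply/subset_leq_card/subsetP.
    move=> x; rewrite unfold_in !inE.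
    by case/andP=> /andP[/andP[/andP[-> ->] _] _] ->.
  by move=> x; rewrite !inE /Q => /andP[/andP[_ ->] ->].
have cQ (Y : {set V}) :
    #|[pred A : {set V} | (A \subset Y) && (#|A| == 2)]| = 'C(#|Y|, 2).
  by rewrite -cards_draws; apply: eq_card => A; rewrite !inE.
have hsum : \sum_(A | Q A) #|joining A| + 2 * 'C(#|D|, 2) <= 3 * 'C(#|X|, 2).
  (* Pairs inside [D] become an indicator on the pairs of [X], so that [joining2_le] can be summed
     termwise. *)
  have -> : 2 * 'C(#|D|, 2) = \sum_(A | Q A) 2 * (A \subset D).
    rewrite -big_distrr /=; congr (2 * _).
    rewrite -(cQ D) -sum1_card [RHS]big_mkcond [LHS]big_mkcond /=.
    apply: eq_bigr => A _; rewrite inE /Q.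
    case: (boolP (A \subset D)) => [sAD|_]; last by case: ifP.
    by rewrite (subset_trans sAD) //; apply/subsetP => v; rewrite inE => /andP[].
  rewrite -big_split /= mulnC -(cQ X) -sum_nat_const.
  apply: leq_sum => A /andP[sAX /eqP A2]; apply: leq_trans (joining2_le A2).
  rewrite leq_add2l leq_mul2l /=.
  case: (boolP (A \subset D)) => // sAD; rewrite lt0b.
  apply/forall_inP => v /(subsetP sAD); by rewrite inE => /andP[].
have hK : #|K| <=
    #|[set x in K | #|ends x| == 1]| + #|[set x in K | #|ends x| == 2]|.
  apply: leq_trans (leq_card_setU _ _); apply/subset_leq_card/subsetP => x xK.
  have xS : x \in ground N :\ e by move: xK; rewrite inE => /andP[].
  case: hrep => /(_ x xS) + _; move: xK; rewrite !inE => -> /=.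
  by move: #|_| => [|[|[|]]].
have hD : 2 * #|D| <= 2 * 'C(#|D|, 2) + 3.
  by case: #|D| => // n; rewrite binS bin1; clear; lia.
by move: hK hK1 hK2 hsum hD; clear; lia.
Qed.

Lemma ground_le_count : #|ground N| <= 3 * 'C(rank N, 2) + rank N + 4.
Proof.
pose S := ground N :\ e.
have [hcard hind] := hrep.
have h0 : indep N set0 && (set0 \subset S) by rewrite indep0 sub0set.
have [B /maxsetP[/andP[hB sB] maxB] _] :=
  maxset_exists (P := fun I => indep N I && (I \subset S)) h0.
have rB : #|B| <= rank N by apply: (bigmax_sup B).
have hBe : hall ends B by rewrite -hind.
pose tgt A := (A \subset B) && (#|cov ends A| <= #|A|).
pose U := \bigcup_(A | tgt A) A.
have /andP[sUB tU] : tgt U.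
  rewrite /U; elim/big_ind: _ => [|A A' /andP[sA tA] /andP[sA' tA']|A] //.
    by rewrite /tgt sub0set /cov big_set0 cards0.
  by rewrite /tgt subUset sA sA' (hall_tightU hBe).
set X := cov ends U in tU.
(* By maximality of [B], an element outside [B] has its ends covered by a tight subset of [B], hence
   by [U]. *)
have sS : S \subset [set x in S | ends x \subset X] :|: (B :\: U).
  apply/subsetP => x xS; rewrite !inE -in_setD1 xS /=.
  have [xU|xU] := boolP (x \in U); first by rewrite [ends x \subset _]bigcup_sup.
  have [xB|xB] := boolP (x \in B); first by rewrite orbT.
  rewrite orbF /=.
  have nx : ~~ hall ends (x |: B).
    have sxB : x |: B \subset S by rewrite subUset sub1set xS.
    rewrite -hind //; apply: contra xB => hxB.
    by rewrite -(maxB (x |: B)) ?subsetUr ?setU11 // hxB.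
  have [A [sA tA sx]] := hall_tight hBe xB nx.
  apply: subset_trans sx (covS _ _); apply: bigcup_sup.
  by rewrite /tgt sA.
have := leq_trans (subset_leq_card sS) (leq_card_setU _ _).
have hX := spanned_le X; have hBU := cardsD B U.
have /eqP := cardsD1 e (ground N); rewrite eN -/S => /eqP ->.
have hUB := subset_leq_card sUB.
rewrite (setIidPr sUB) in hBU.
have hC : 'C(#|X|, 2) <= 'C(rank N, 2).
  by apply: leq_bin2l; apply: leq_trans tU (leq_trans hUB rB).
(* The constant 4 is the 3 of [spanned_le] plus 1 for [e]; the linear term bounds [B :\: U]. *)
move: hX hBU hUB hC rB tU; rewrite -/S; clear; lia.
Qed.

End Count.

End ExcludedMinor.

Theorem lemma7p7 (T : finType) (N : matroid T) (hN : excluded_minor N) :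
  #|ground N| <= 3 * 'C(rank N, 2) + rank N + 4.
Proof.
have [->|[e eN]] := set_0Vmem (ground N); first by rewrite cards0.
have [V [ends hrep]] := excluded_minor_represents hN eN.
exact (ground_le_count hN eN hrep).
Qed.
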